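(* Let $\mathbf{2}$ be the two-element Boolean algebra and $\mathbf{4}$ the four-element double Stone algebra on the chain $0<u_2<u_1<1$. (i) For every set $I$, the sets of completely join irreducible elements of $\mathbf{4}^{I}$ and of $(\mathbf{2}^{I})^{[3]}$ are order isomorphic, and $\mathbf{4}^{I}$ and $(\mathbf{2}^{I})^{[3]}$ are lattice isomorphic. (ii) For every set $I$, $\mathbf{4}^{I}$ and $(\mathbf{2}^{I})^{[3]}$ are isomorphic as double Stone algebras. (iii) For every double Stone algebra $\mathcal{DBS}$ there exists a set $I$ such that $\mathcal{DBS}$ can be embedded into the double Stone algebra $(\mathbf{2}^{I})^{[3]}$.
   Context: A double Stone algebra is an algebra $(A,\vee,\wedge,\sim,\neg,0,1)$ such that $(A,\vee,\wedge,0,1)$ is a bounded distributive lattice; for every $a\in A$, $\sim a=\max\{c\in A:a\wedge c=0\}$ and $\neg a=\min\{c\in A:a\vee c=1\}$ exist; and $\sim a\vee\sim\sim a=1$, $\neg a\wedge\neg\neg a=0$ for all $a$. The one-element algebra is allowed. For a Boolean algebra $B$ with complement $^{c}$, $B^{[3]}:=\{(b_1,b_2,b_3)\in B^3:b_1\le b_2\le b_3\}$ with componentwise $\vee,\wedge$, bottom $(0,0,0)$, top $(1,1,1)$, $\sim(b_1,b_2,b_3):=(b_3^{c},b_3^{c},b_3^{c})$ and $\neg(b_1,b_2,b_3):=(b_1^{c},b_1^{c},b_1^{c})$; this is a double Stone algebra. $\mathbf{4}$ is the chain $0<u_2<u_1<1$ with $\sim 0=1$, $\sim u_1=\sim u_2=\sim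 1=0$, $\neg 1=0$, $\neg 0=\neg u_1=\neg u_2=1$. Powers carry pointwise operations. In a complete lattice $L$, $a\in L$ is completely join irreducible if $a=\bigvee S$ implies $a\in S$ for every subset $S\subseteq L$. Sets of completely join irreducible elements carry the induced order. Embeddings and isomorphisms preserve all operations of the indicated signature, including $0$ and $1$. *)

(* Defs.v *)
From HB Require Import structures.
Set Warnings "-notation-overridden".
From mathcomp Require Import all_boot all_order.
From mathcomp Require Import boolp classical_sets.

Set Implicit Arguments.
Unset Strict Implicit.
Unset Printing Implicit Defensive.

Import Order.Theory.
Local Open Scope classical_set_scope.
Local Open Scope order_scope.

Definition is_max {d} {T : porderType d} (S : set T) (m : T) : Prop :=
  S m /\ ubound S m.
Definition is_min {d} {T : porderType d} (S : set T) (m : T) : Prop :=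
  S m /\ lbound S m.

(* [sim] is the operation written ~, [neg] the one written with a logical
   negation sign.  The choice structure that an order carries puts no condition
   on the carrier: [gen_choiceMixin] builds one on any type. *)
HB.mixin Record isDoubleStone d T of Order.TBDistrLattice d T := {
  sim : T -> T;
  neg : T -> T;
  sim_max : forall a : T, is_max [set c : T | a `&` c = \bot] (sim a);
  neg_min : forall a : T, is_min [set c : T | a `|` c = \top] (neg a);
  sim_stone : forall a : T, sim a `|` sim (sim a) = \top;
  neg_stone : forall a : T, neg a `&` neg (neg a) = \bot;
}.

#[short(type="doubleStoneType")]
HB.structure Definition DoubleStone d :=
  {T of Order.TBDistrLattice d T & isDoubleStone d T}.

Section Power.
Variable I : Type.

Section TBDistr.
Context {d} {T : tbDistrLatticeType d}.
Implicit Types f g : I -> T.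

Fact fun_meetUl : left_distributive (Order.meet : (I -> T) -> _ -> _) Order.join.
Proof. by move=> f g h; apply/funext => i; exact: meetUl. Qed.
HB.instance Definition _ :=
  Order.Lattice_Meet_isDistrLattice.Build _ (I -> T) fun_meetUl.

Definition fun_bot : I -> T := fun=> \bot.
Fact fun_le0x f : fun_bot <= f.
Proof. by apply/lefP => i; exact: le0x. Qed.
HB.instance Definition _ := Order.hasBottom.Build _ (I -> T) fun_le0x.

Definition fun_top : I -> T := fun=> \top.
Fact fun_lex1 f : f <= fun_top.
Proof. by apply/lefP => i; exact: lex1. Qed.
HB.instance Definition _ := Order.hasTop.Build _ (I -> T) fun_lex1.

End TBDistr.

Section Boolean.
Context {d} {T : ctbDistrLatticeType d}.
Implicit Types f : I -> T.

Definition fun_compl f : I -> T := fun i => ~` f i.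
Fact fun_joinxC f : f `|` fun_compl f = \top.
Proof. by apply/funext => i; exact: joinxC. Qed.
Fact fun_meetxC f : f `&` fun_compl f = \bot.
Proof. by apply/funext => i; exact: meetxC. Qed.
HB.instance Definition _ :=
  Order.TBDistrLattice_hasComplement.Build _ (I -> T) fun_joinxC fun_meetxC.

End Boolean.

Section DoubleStone.
Context {d} {T : doubleStoneType d}.
Implicit Types f : I -> T.

Definition fun_sim f : I -> T := fun i => sim (f i).
Definition fun_neg f : I -> T := fun i => neg (f i).

Fact fun_simP f : is_max [set g : I -> T | f `&` g = \bot] (fun_sim f).
Proof.
split=> [|g fg0]; first by apply/funext => i; exact: (sim_max (f i)).1.
by apply/lefP => i; apply: (sim_max (f i)).2; exact: (congr1 (@^~ i) fg0).
Qed.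

Fact fun_negP f : is_min [set g : I -> T | f `|` g = \top] (fun_neg f).
Proof.
split=> [|g fg1]; first by apply/funext => i; exact: (neg_min (f i)).1.
by apply/lefP => i; apply: (neg_min (f i)).2; exact: (congr1 (@^~ i) fg1).
Qed.

Fact fun_sim_stone f : fun_sim f `|` fun_sim (fun_sim f) = \top.
Proof. by apply/funext => i; exact: sim_stone. Qed.
Fact fun_neg_stone f : fun_neg f `&` fun_neg (fun_neg f) = \bot.
Proof. by apply/funext => i; exact: neg_stone. Qed.

HB.instance Definition _ := isDoubleStone.Build _ (I -> T)
  fun_simP fun_negP fun_sim_stone fun_neg_stone.

End DoubleStone.
End Power.

(* The ordinals 0, 1, 2, 3 stand for 0 < u_2 < u_1 < 1. *)
Definition four : Type := 'I_4.
HB.instance Definition _ := Order.Total.copy four 'I_4.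
HB.instance Definition _ :=
  Order.hasBottom.Build _ four (leq0n : forall x : four, (ord0 : four) <= x).
HB.instance Definition _ :=
  Order.hasTop.Build _ four (@leq_ord 3 : forall x : four, x <= (ord_max : four)).

Section Four.
Implicit Types x : four.

Definition four_sim x : four := if x == \bot then \top else \bot.
Definition four_neg x : four := if x == \top then \bot else \top.

Fact four_simP x : is_max [set c : four | x `&` c = \bot] (four_sim x).
Proof.
rewrite /four_sim; case: eqP => [->|/eqP x0].
  by split=> [|c _]; [exact: meet0x|exact: lex1].
split=> [|c /=]; first exact: meetx0.
by case: (leP x c) => _ xc; rewrite ?xc// -xc eqxx in x0 *.
Qed.

Fact four_negP x : is_min [set c : four | x `|` c = \top] (four_neg x).
Proof.
rewrite /four_neg; case: eqP => [->|/eqP x1].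
  by split=> [|c _]; [exact: join1x|exact: le0x].
split=> [|c /=]; first exact: joinx1.
by case: (leP c x) => _ xc; rewrite ?xc// -xc eqxx in x1 *.
Qed.

Fact four_sim_stone x : four_sim x `|` four_sim (four_sim x) = \top.
Proof. by rewrite /four_sim; case: (x == \bot); [exact: join1x|exact: join0x]. Qed.

Fact four_neg_stone x : four_neg x `&` four_neg (four_neg x) = \bot.
Proof. by rewrite /four_neg; case: (x == \top); [exact: meet0x|exact: meet1x]. Qed.

HB.instance Definition _ := isDoubleStone.Build _ four
  four_simP four_negP four_sim_stone four_neg_stone.

End Four.

Section Triple.
Context {d} (B : ctbDistrLatticeType d).

Definition increasing (b : B *p B *p B) : bool := b.1.1 <= b.1.2 <= b.2.

(* [triple B] is B^[3]; [*p] carries the componentwise order. *)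
Record triple : Type := Triple {
  triple_val : B *p B *p B;
  _ : increasing triple_val
}.

HB.instance Definition _ := [isSub for triple_val].
HB.instance Definition _ := [Choice of triple by <:].

Fact increasing_meet : Order.ClosedPredicates.meet_closed increasing.
Proof.
move=> x y /andP[x12 x23] /andP[y12 y23].
by apply/andP; split; exact: leI2.
Qed.
Fact increasing_join : Order.ClosedPredicates.join_closed increasing.
Proof.
move=> x y /andP[x12 x23] /andP[y12 y23].
by apply/andP; split; exact: leU2.
Qed.
Fact increasing0 : \bot \in increasing.
Proof. by apply/andP; split; exact: le0x. Qed.
Fact increasing1 : \top \in increasing.
Proof. by apply/andP; split; exact: lex1. Qed.

HB.instance Definition _ := Order.SubChoice_isTBSubLattice.Build
  _ _ increasing d triple
  increasing_meet increasing_join increasing0 increasing1.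

Fact triple_meetUl : left_distributive (Order.meet : triple -> _ -> _) Order.join.
Proof.
move=> x y z; apply: val_inj.
exact: (meetUl (triple_val x) (triple_val y) (triple_val z)).
Qed.
HB.instance Definition _ :=
  Order.Lattice_Meet_isDistrLattice.Build d triple triple_meetUl.

Implicit Types x y : triple.

Fact increasing_diag (b : B) : increasing (b, b, b).
Proof. by apply/andP. Qed.
Definition diag (b : B) : triple := Triple (increasing_diag b).

Definition triple_sim x : triple := diag (~` (triple_val x).2).
Definition triple_neg x : triple := diag (~` (triple_val x).1.1).

Fact triple_le x y : (x <= y) =
  [&& (triple_val x).1.1 <= (triple_val y).1.1,
      (triple_val x).1.2 <= (triple_val y).1.2 &
      (triple_val x).2 <= (triple_val y).2].
Proof. by rewrite andbA. Qed.

Fact triple_sim_max x :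
  is_max [set c : triple | x `&` c = \bot] (triple_sim x).
Proof.
case: x => [[[x1 x2] x3] x123]; have /andP[/= x12 x23] := x123.
split=> [|[[[c1 c2] c3] c123] /(congr1 val)].
  apply: val_inj; congr (_, _, _) => /=; apply/eqP; rewrite -lex0 -(meetxC x3);
    by apply: leI2 => //; exact: le_trans x23.
have /andP[/= c12 c23] := c123.
move=> [_ _ xc3]; have c3x : c3 <= ~` x3 by rewrite -disj_leC meetC xc3.
by rewrite triple_le /= c3x !(le_trans _ c3x)// (le_trans c12).
Qed.

Fact triple_neg_min x :
  is_min [set c : triple | x `|` c = \top] (triple_neg x).
Proof.
case: x => [[[x1 x2] x3] x123]; have /andP[/= x12 x23] := x123.
split=> [|[[[c1 c2] c3] c123] /(congr1 val)].
  apply: val_inj; congr (_, _, _) => /=; apply/eqP; rewrite -le1x -(joinxC x1);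
    by apply: leU2 => //; exact: le_trans x12 _.
have /andP[/= c12 c23] := c123.
move=> [xc1 _ _]; have x1c : ~` x1 <= c1.
  by rewrite -[leLHS]meet1x -xc1 meetUl meetxC join0x leIl.
by rewrite triple_le /= x1c !(le_trans x1c)// (le_trans c12).
Qed.

Fact triple_sim_stone x : triple_sim x `|` triple_sim (triple_sim x) = \top.
Proof. by apply: val_inj; congr (_, _, _); exact: joinxC. Qed.

Fact triple_neg_stone x : triple_neg x `&` triple_neg (triple_neg x) = \bot.
Proof. by apply: val_inj; congr (_, _, _); exact: meetxC. Qed.

HB.instance Definition _ := isDoubleStone.Build d triple
  triple_sim_max triple_neg_min triple_sim_stone triple_neg_stone.

End Triple.

Definition complete {d} (L : porderType d) : Prop :=
  forall S : set L, exists a, supremums S a.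

Fact fin_complete {d} (F : finType) (L : bLatticeType d) (e : F -> L) (e' : L -> F) :
  cancel e' e -> complete L.
Proof.
move=> e'K S; exists (\join_(x : F | e x \in S) e x); split=> [a Sa|b Sb].
  by rewrite -(e'K a); apply: joins_sup; rewrite e'K inE.
by apply/joinsP => x; rewrite inE => /Sb.
Qed.

Fact bool_complete : complete bool.
Proof. exact: (@fin_complete _ bool bool id id). Qed.

Fact four_complete : complete four.
Proof. exact: (@fin_complete _ 'I_4 four id id). Qed.

Fact fun_complete (I : Type) d (T : porderType d) : complete T -> complete (I -> T).
Proof.
move=> cT S; have /choice[f fS] i := cT [set g i | g in S].
exists f; split=> [g Sg|g Sg]; apply/lefP => i.
  by apply: (fS i).1; exists g.
by apply: (fS i).2 => _ [h Sh <-]; exact: (lefP _ _ (Sg h Sh)).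
Qed.

Fact triple_complete d (B : ctbDistrLatticeType d) : complete B -> complete (triple B).
Proof.
move=> cB S.
have [b1 b1S] := cB [set (triple_val x).1.1 | x in S].
have [b2 b2S] := cB [set (triple_val x).1.2 | x in S].
have [b3 b3S] := cB [set (triple_val x).2 | x in S].
have b123 : increasing (b1, b2, b3).
  apply/andP; split=> /=.
  - apply: b1S.2 => _ [x Sx <-]; have /andP[+ _] := valP x.
    by move=> /le_trans; apply; apply: b2S.1; exists x.
  - apply: b2S.2 => _ [x Sx <-]; have /andP[_] := valP x.
    by move=> /le_trans; apply; apply: b3S.1; exists x.
exists (Triple b123); split=> [x Sx|y Sy]; rewrite triple_le /=.
  by apply/and3P; split; [apply: b1S.1|apply: b2S.1|apply: b3S.1]; exists x.
apply/and3P; split; [apply: b1S.2|apply: b2S.2|apply: b3S.2] => _ [x Sx <-];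
  by have := Sy x Sx; rewrite triple_le => /and3P[].
Qed.

Fact power_four_complete (I : Type) : complete (I -> four).
Proof. exact/fun_complete/four_complete. Qed.

Fact triple_power_two_complete (I : Type) : complete (triple (I -> bool)).
Proof. exact/triple_complete/fun_complete/bool_complete. Qed.

(* [supremums S a] says that [a] is the join of [S]; every [S] has one when [L]
   is complete. *)
Definition cji {d} (L : latticeType d) : set L :=
  [set a | forall S : set L, supremums S a -> S a].
Arguments cji {d} L _.

Definition order_isomorphic {d d'} {T : porderType d} {T' : porderType d'}
    (A : set T) (A' : set T') : Prop :=
  exists f : A -> A', bijective f /\
    forall x y : A, (val (f x) <= val (f y)) = (val x <= val y).

Definition bounded_lattice_morphism {d d'}
    {L : tbLatticeType d} {L' : tbLatticeType d'} (f : L -> L') : Prop :=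
  [/\ Order.meet_morphism f, Order.join_morphism f,
      f \bot = \bot & f \top = \top].

Definition lattice_isomorphic {d d'}
    (L : tbLatticeType d) (L' : tbLatticeType d') : Prop :=
  exists f : L -> L', bounded_lattice_morphism f /\ bijective f.

Definition double_stone_morphism {d d'}
    {A : doubleStoneType d} {A' : doubleStoneType d'} (f : A -> A') : Prop :=
  [/\ bounded_lattice_morphism f, {morph f : x / sim x} & {morph f : x / neg x}].

Definition double_stone_isomorphic {d d'}
    (A : doubleStoneType d) (A' : doubleStoneType d') : Prop :=
  exists f : A -> A', double_stone_morphism f /\ bijective f.

Definition double_stone_embeddable {d d'}
    (A : doubleStoneType d) (A' : doubleStoneType d') : Prop :=
  exists f : A -> A', double_stone_morphism f /\ injective f.

(* Main.v *)
(** Sending [x : four] to the three answers to "x >= 1?", "x >= u_1?" and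
"x >= u_2?" identifies [four] with [triple bool], and hence, coordinatewise,
[I -> four] with [triple (I -> bool)].  For an arbitrary double Stone algebra
[A], the maps [neg \o neg] and [sim \o sim] are bounded lattice endomorphisms
with [neg (neg a) <= a <= sim (sim a)], whose values are complemented.  So, if
[I] is the set of bounded lattice morphisms [h : A -> bool], then
[a |-> (h (neg (neg a)), h a, h (sim (sim a)))_h] is a double Stone morphism;
its middle component is injective by the prime filter theorem. *)
Require Import Defs.
Set Warnings "-notation-overridden".
From mathcomp Require Import all_boot all_order.
From mathcomp Require Import boolp classical_sets.

Set Implicit Arguments.
Unset Strict Implicit.
Unset Printing Implicit Defensive.

Import Order.Theory.
Local Open Scope classical_set_scope.
Local Open Scope order_scope.

(** * Transport of completely join irreducible elements *)

Lemma cji_le_mono d d' (L : latticeType d) (L' : latticeType d')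
    (f : L -> L') (g : L' -> L) (x : L) :
  {mono f : x y / x <= y} -> cancel f g -> cancel g f ->
  cji L x -> cji L' (f x).
Proof.
move=> f_le fK gK cjix S [ubS lubS].
(* A set with supremum [f x] pulls back along [g] to a set with supremum [x]. *)
have [|y Sy <-] := cjix (g @` S); last by rewrite gK.
split=> [_ [y Sy <-]|z ubz]; first by rewrite -f_le gK; exact: ubS.
by rewrite -f_le; apply: lubS => y Sy; rewrite -(gK y) f_le; apply: ubz; exists y.
Qed.

Lemma cji_order_isomorphic d d' (L : latticeType d) (L' : latticeType d')
    (f : L -> L') :
  {mono f : x y / x <= y} -> bijective f -> order_isomorphic (cji L) (cji L').
Proof.
move=> f_le [g fK gK].
have g_le : {mono g : x y / x <= y} by move=> x y; rewrite -f_le !gK.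
have cjif (x : cji L) : f (val x) \in cji L'.
  by apply: mem_set; apply: (cji_le_mono f_le fK gK); exact: set_mem (valP x).
have cjig (y : cji L') : g (val y) \in cji L.
  by apply: mem_set; apply: (cji_le_mono g_le gK fK); exact: set_mem (valP y).
exists (fun x => SigSub (cjif x)); split=> [|x y]; last exact: f_le.
exists (fun y => SigSub (cjig y)) => [x|y]; apply: val_inj => /=.
  exact: fK.
exact: gK.
Qed.

Lemma bounded_lattice_morphism_le_mono d d' (L : tbLatticeType d)
    (L' : tbLatticeType d') (f : L -> L') :
  bounded_lattice_morphism f -> injective f -> {mono f : x y / x <= y}.
Proof. by move=> [fI _ _ _] f_inj x y; rewrite !leEmeet -fI (inj_eq f_inj). Qed.

(** * Powers of the four-element chain as triples *)

Definition above (k : nat) (x : four) : bool := (k < (x : 'I_4))%N.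

Lemma aboveI k x y : above k (x `&` y) = above k x && above k y.
Proof.
by rewrite /above; case: (leP x y) => [|/ltW] xy; [rewrite andbC|];
  rewrite andb_idl// => /leq_trans; apply.
Qed.

Lemma aboveU k x y : above k (x `|` y) = above k x || above k y.
Proof.
by rewrite /above; case: (leP x y) => [|/ltW] xy; [|rewrite orbC];
  rewrite orb_idl// => /leq_trans; apply.
Qed.

(** [sim] takes only the values [\bot] and [\top], on which the thresholds 0, 1 and 2 agree; this
    matches the constant triples given by [triple_sim]. *)
Lemma above_sim k x : (k < 3)%N -> above k (sim x) = ~~ above 0 x.
Proof.
move=> k3; rewrite /above /sim /= /four_sim.
by case: x => [[|n] n4] /=; rewrite /eq_op/= ?k3.
Qed.

Lemma above_neg k x : (k < 3)%N -> above k (neg x) = ~~ above 2 x.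
Proof.
move=> k3; rewrite /above /neg /= /four_neg.
by case: x => [[|[|[|[|n]]]] n4] //=; rewrite /eq_op/= ?k3.
Qed.

Section PowerFour.
Variable I : Type.

Fact increasing_above (f : I -> four) :
  increasing (above 2 \o f, above 1 \o f, above 0 \o f).
Proof.
by apply/andP; split; apply/lefP => i /=; rewrite /above; case: (f i) => [[|[|[|[|]]]]].
Qed.

Definition four_to_triple (f : I -> four) : triple (I -> bool) :=
  Triple (increasing_above f).

(** The three bits are increasing, so their number of ones determines them and is the position in
    the chain. It is at most 3, so [inord] never takes its default value. *)
Definition triple_to_four (x : triple (I -> bool)) : I -> four := fun i =>
  inord ((triple_val x).1.1 i + (triple_val x).1.2 i + (triple_val x).2 i).

Lemma four_to_tripleK : cancel four_to_triple triple_to_four.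
Proof.
move=> f; apply/funext => i; apply: val_inj; rewrite /triple_to_four /= /above.
by case: (f i) => [[|[|[|[|]]]]] //= ?; rewrite inordK.
Qed.

Lemma triple_to_fourK : cancel triple_to_four four_to_triple.
Proof.
case=> [[[x1 x2] x3] x123]; have /andP[/= /lefP x12 /lefP x23] := x123.
apply: val_inj; congr (_, _, _); apply/funext => i;
  move: (x12 i) (x23 i); rewrite /above /triple_to_four /=;
  by case: (x1 i) (x2 i) (x3 i) => [] [] [] //= _ _; rewrite inordK.
Qed.

Lemma four_to_triple_bij : bijective four_to_triple.
Proof. by exists triple_to_four; [exact: four_to_tripleK|exact: triple_to_fourK]. Qed.

Lemma four_to_triple_morphism : double_stone_morphism four_to_triple.
Proof.
split; first split.
- by move=> f g; apply: val_inj; congr (_, _, _); apply/funext => i; exact: aboveI.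
- by move=> f g; apply: val_inj; congr (_, _, _); apply/funext => i; exact: aboveU.
- by apply: val_inj; congr (_, _, _).
- by apply: val_inj; congr (_, _, _).
- by move=> f; apply: val_inj; congr (_, _, _); apply/funext => i; exact: above_sim.
- by move=> f; apply: val_inj; congr (_, _, _); apply/funext => i; exact: above_neg.
Qed.

End PowerFour.

(** * Pseudocomplements with the Stone identity *)

Section Stone.
Context {d} {T : tbDistrLatticeType d} (s : T -> T).
Hypothesis s_max : forall a, is_max [set c | a `&` c = \bot] (s a).
Hypothesis s_stone : forall a, s a `|` s (s a) = \top.

Lemma stone_meetxs a : a `&` s a = \bot. Proof. exact: (s_max a).1. Qed.

Lemma stone_leP a c : reflect (a `&` c = \bot) (c <= s a).
Proof.
apply: (iffP idP) => [ca|]; last exact: (s_max a).2.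
by apply/eqP; rewrite -lex0 -(stone_meetxs a); exact: leI2.
Qed.

Lemma stone_le_ss a : a <= s (s a).
Proof. by apply/stone_leP; rewrite meetC stone_meetxs. Qed.

Lemma stone_anti a b : a <= b -> s b <= s a.
Proof.
move=> ab; apply/stone_leP/eqP; rewrite -lex0 -(stone_meetxs b); exact: leI2.
Qed.

(** By distributivity, [s a] is the join of its meets with [a] and with [b], and the first of these
    is [\bot]. *)
Lemma stone_compl a b : a `&` b = \bot -> a `|` b = \top -> s a = b.
Proof.
move=> ab0 ab1; apply/le_anti/andP; split; last exact/stone_leP.
by rewrite -[s a]meetx1 -ab1 meetUr [s a `&` a]meetC stone_meetxs join0x leIr.
Qed.

Lemma stone_sssE a : s (s (s a)) = s a.
Proof.
by apply: stone_compl; [rewrite meetC stone_meetxs|rewrite joinC s_stone].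
Qed.

Lemma stone_sU a b : s (a `|` b) = s a `&` s b.
Proof.
apply/le_anti/andP; split.
  by rewrite lexI !stone_anti ?leUl ?leUr.
apply/stone_leP; rewrite meetUl meetA stone_meetxs meet0x meetCA stone_meetxs.
by rewrite meetx0 joinx0.
Qed.

(** For the inequality from left to right, the Stone identity splits [t] into its parts below [s b]
    and below [s (s b)]; the latter part lies below [s a]. *)
Lemma stone_sI a b : s (a `&` b) = s a `|` s b.
Proof.
apply/le_anti/andP; split; last by rewrite leUx !stone_anti ?leIl ?leIr.
set t := s _; have tab : (t `&` a) <= s b.
  by apply/stone_leP; rewrite meetC -meetA meetC stone_meetxs.
have tb : t `&` s (s b) <= s a.
  apply/stone_leP; rewrite meetA [a `&` t]meetC.
  by apply/eqP; rewrite -lex0 -(stone_meetxs (s b)); exact: leI2.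
rewrite -[t]meetx1 -(s_stone b) meetUr joinC; apply: leU2 => //; exact: leIr.
Qed.

Lemma stone_s0 : s \bot = \top.
Proof. by apply: stone_compl; rewrite ?meet0x ?join0x. Qed.

Lemma stone_s1 : s \top = \bot.
Proof. by apply: stone_compl; rewrite ?meet1x ?join1x. Qed.

Lemma stone_ss_morphism : bounded_lattice_morphism (s \o s).
Proof.
by split=> [a b|a b||] /=; rewrite ?(stone_sI, stone_sU, stone_s0, stone_s1).
Qed.

End Stone.

(** * The two operations of a double Stone algebra *)

Section DoubleStone.
Context {d} {A : doubleStoneType d}.
Implicit Types a b : A.

Let sim_compl := stone_compl (@sim_max d A).
(** [neg] is a pseudocomplement for the reversed order, so each fact about [s] is read once in [A]
    and once in [A^d]. *)
Let neg_compl := @stone_compl _ A^d _ (@neg_min d A).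

Lemma meetxsim a : a `&` sim a = \bot.
Proof. exact: (stone_meetxs (@sim_max d A)). Qed.

Lemma joinxneg a : a `|` neg a = \top.
Proof. exact: (@stone_meetxs _ A^d _ (@neg_min d A)). Qed.

Lemma le_simsim a : a <= sim (sim a).
Proof. exact: (stone_le_ss (@sim_max d A)). Qed.

Lemma le_negneg a : neg (neg a) <= a.
Proof. exact: (@stone_le_ss _ A^d _ (@neg_min d A)). Qed.

Lemma simsim_morphism : bounded_lattice_morphism (sim \o sim : A -> A).
Proof. exact: (stone_ss_morphism (@sim_max d A) (@sim_stone d A)). Qed.

Lemma negneg_morphism : bounded_lattice_morphism (neg \o neg : A -> A).
Proof.
(* Duality exchanges meet with join and bottom with top, so [nI] concerns joins of [A]. *)
have [nI nU n0 n1] :=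
  @stone_ss_morphism _ A^d _ (@neg_min d A) (@neg_stone d A).
by split.
Qed.

Lemma simsimsim a : sim (sim (sim a)) = sim a.
Proof. exact: (stone_sssE (@sim_max d A) (@sim_stone d A)). Qed.

Lemma negnegneg a : neg (neg (neg a)) = neg a.
Proof. exact: (@stone_sssE _ A^d _ (@neg_min d A) (@neg_stone d A)). Qed.

(** Both operations send a complemented element to its complement, and [sim a] is complemented by
    the Stone identity. *)
Lemma neg_sim a : neg (sim a) = sim (sim a).
Proof. by apply: neg_compl; [exact: sim_stone|exact: meetxsim]. Qed.

Lemma sim_neg a : sim (neg a) = neg (neg a).
Proof. by apply: sim_compl; [exact: neg_stone|exact: joinxneg]. Qed.

End DoubleStone.

(** * The prime filter theorem *)

Section PrimeFilter.
Context {d} {T : tbDistrLatticeType d}.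

Lemma exists_separating_morphism (a b : T) : ~~ (a <= b) ->
  exists2 h : T -> bool, bounded_lattice_morphism h & h a && ~~ h b.
Proof.
move=> Nab.
(* The condition [~~ (x `&` a <= b)] keeps [b] outside [F] and forces a maximal
   [F] to contain [a], while it still admits the empty set, as Zorn_bigcup
   requires. *)
pose P := [set F : set T | [/\ forall x y, F x -> F y -> F (x `&` y),
  forall x y, F x -> x <= y -> F y & forall x, F x -> ~~ (x `&` a <= b)]].
have [F [[FI Fup Fb] Fmax]] : exists F, P F /\ forall G, F `<` G -> ~ P G.
  apply: Zorn_bigcup => C CP Ctot; split=> [x y [X CX Xx] [Y CY Yy]|x y [X CX Xx] xy|x [X CX Xx]].
  - have [XY|YX] := Ctot X Y CX CY.
      by exists Y => //; have [+ _ _] := CP Y CY; apply=> //; exact: XY.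
    by exists X => //; have [+ _ _] := CP X CX; apply=> //; exact: YX.
  - by exists X => //; have [_ + _] := CP X CX; apply; eauto.
  - by have [_ _] := CP X CX; apply.
(* [F] might still be empty at this point; [F1] is not. *)
pose F1 : set T := F `|` [set \top].
have F1I x y : F1 x -> F1 y -> F1 (x `&` y).
  move=> [Fx|->] [Fy|->]; rewrite ?meet1x ?meetx1; try by [left|right].
  by left; exact: FI.
(* Otherwise the filter [G] generated by [F1] and [x] would satisfy [P] and properly contain [F]. *)
have Fadd x : ~ F x -> exists2 y, F1 y & y `&` x `&` a <= b.
  move=> NFx; apply/not_exists2P => NG.
  pose G := [set z | exists2 y, F1 y & y `&` x <= z].
  apply: (Fmax G).
    split=> [z Fz|GF]; first by exists z; [left|exact: leIl].
    by apply: NFx; apply: GF; exists \top; [right|exact: leIr].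
  split=> [u v [y Fy yu] [z Fz zv]|u v [y Fy yu] uv|u [y Fy yu]].
  - exists (y `&` z); first exact: F1I.
    by rewrite lexI (le_trans _ yu) ?(le_trans _ zv)// leI2 ?leIl ?leIr.
  - by exists y => //; exact: le_trans uv.
  - have [//|/negP] := NG y; apply: contra; apply: le_trans; exact: leI2.
have F1F x : F1 x -> F x.
  move=> [//|->]; apply: contrapT => NF1.
  have [y [Fy _|->]] := Fadd _ NF1; first exact: NF1 (Fup _ _ Fy (lex1 y)).
  by rewrite !meet1x (negbTE Nab).
have Fa : F a.
  apply: contrapT => /Fadd[y /F1F/Fb]; rewrite -meetA meetxx => /negbTE -> //.
have NFb : ~ F b by move=> /Fb; rewrite leIl.
(* Primeness: if both fail, distributivity puts the meet of [u], [v], [x] join [y], and [a] below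
   [b], against [Fb]. *)
have FU x y : F (x `|` y) -> F x \/ F y.
  move=> Fxy; apply: contrapT => /not_orP[/Fadd[u /F1F Fu ux] /Fadd[v /F1F Fv vy]].
  have /negP := Fb _ (FI _ _ (FI _ _ Fu Fv) Fxy); apply.
  rewrite meetUr meetUl leUx (le_trans _ ux) ?(le_trans _ vy)// !leI2//.
    exact: leIr.
  exact: leIl.
exists (fun x => `[< F x >]); last by rewrite asboolT// asboolF.
split=> [x y|x y||].
- apply/asboolP/andP => [Fxy|[/asboolP Fx /asboolP Fy]]; last exact: FI.
  by split; apply/asboolP; apply: (Fup _ _ Fxy); rewrite ?leIl ?leIr.
- apply/asboolP/orP => [/FU[]|[|] /asboolP Fx]; [left|right| |]; try exact/asboolP.
    by apply: (Fup _ _ Fx); exact: leUl.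
  by apply: (Fup _ _ Fx); exact: leUr.
- by apply: asboolF => F0; apply/NFb/(Fup _ _ F0)/le0x.
- by apply: asboolT; apply: F1F; right.
Qed.

End PrimeFilter.

(** * The embedding over the spectrum *)

Section Embedding.
Context {d} {A : doubleStoneType d}.

(** These are the indicators of the proper prime filters. There are none when [A] has one element,
    and the triples over the empty index set then form a one-element algebra too. *)
Definition spectrum : Type := {h : A -> bool | bounded_lattice_morphism h}.

Definition eval (a : A) : spectrum -> bool := fun h => sval h a.

Lemma eval_morphism : bounded_lattice_morphism eval.
Proof.
by split=> [a b|a b||]; apply/funext => -[h hP]; have [hI hU h0 h1] := hP;
  [exact: hI|exact: hU|exact: h0|exact: h1].
Qed.

Lemma eval_le a b : a <= b -> eval a <= eval b.
Proof. by have [eI _ _ _] := eval_morphism; rewrite !leEmeet -eI => /eqP ->. Qed.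

Lemma eval_compl a b : a `&` b = \bot -> a `|` b = \top -> eval a = ~` eval b.
Proof.
have [eI eU e0 e1] := eval_morphism.
move=> /(congr1 eval); rewrite eI e0 => ab0 /(congr1 eval); rewrite eU e1 => ab1.
apply/le_anti/andP; split; first by rewrite -disj_leC ab0.
by rewrite -[leLHS]meet1x -ab1 meetUl meetxC joinx0 leIl.
Qed.

(** [eval] respects complements only, and [a] itself need not be a complement of [sim a];
    [sim (sim a)] is one. *)
Lemma eval_sim a : eval (sim a) = ~` eval (sim (sim a)).
Proof. by apply: eval_compl; [exact: meetxsim|exact: sim_stone]. Qed.

Lemma eval_neg a : eval (neg a) = ~` eval (neg (neg a)).
Proof. by apply: eval_compl; [exact: neg_stone|exact: joinxneg]. Qed.

Lemma eval_inj : injective eval.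
Proof.
have eval_le_mono a b : eval a <= eval b -> a <= b.
  move=> /lefP eab; apply/negPn/negP => /exists_separating_morphism[h hP].
  by case/andP=> ha; move: (eab (exist _ h hP)); rewrite /eval /= ha; case: (h b).
by move=> a b eab; apply/le_anti; rewrite !eval_le_mono ?eab.
Qed.

Fact increasing_eval (a : A) :
  increasing (eval (neg (neg a)), eval a, eval (sim (sim a))).
Proof. by apply/andP; split; apply: eval_le; [exact: le_negneg|exact: le_simsim]. Qed.

Definition eval_triple (a : A) : triple (spectrum -> bool) :=
  Triple (increasing_eval a).

Lemma eval_triple_morphism : double_stone_morphism eval_triple.
Proof.
have [eI eU e0 e1] := eval_morphism.
have [sI sU s0 s1] := @simsim_morphism d A.
have [nI nU n0 n1] := @negneg_morphism d A.
split; first split.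
- move=> a b; apply: val_inj; congr (_, _, _) => /=; rewrite -eI //.
    by congr eval; exact: nI.
  by congr eval; exact: sI.
- move=> a b; apply: val_inj; congr (_, _, _) => /=; rewrite -eU //.
    by congr eval; exact: nU.
  by congr eval; exact: sU.
- by apply: val_inj; congr (_, _, _) => //=; rewrite -e0; congr eval.
- by apply: val_inj; congr (_, _, _) => //=; rewrite -e1; congr eval.
(* All components of the image of [sim a] are [eval (sim a)], since [neg (neg (sim a))] and
   [sim (sim (sim a))] both reduce to [sim a]. *)
- by move=> a; apply: val_inj; congr (_, _, _); rewrite /= -eval_sim ?neg_sim ?simsimsim.
- by move=> a; apply: val_inj; congr (_, _, _); rewrite /= -eval_neg ?sim_neg ?negnegneg.
Qed.

Lemma eval_triple_inj : injective eval_triple.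
Proof. by move=> a b /(congr1 val)[_ /eval_inj]. Qed.

End Embedding.

Theorem theorem13 :
  [/\ forall I : Type,
        order_isomorphic (cji (I -> four)) (cji (triple (I -> bool))) /\
        lattice_isomorphic (I -> four) (triple (I -> bool)),
      forall I : Type,
        double_stone_isomorphic (I -> four) (triple (I -> bool)) &
      forall (d : Order.disp_t) (A : doubleStoneType d),
        exists I : Type, double_stone_embeddable A (triple (I -> bool))].
Proof.
split=> [I|I|d A].
- have [fM _ _] := four_to_triple_morphism I.
  split; last by exists (@four_to_triple I); split=> //; exact: four_to_triple_bij.
  apply: cji_order_isomorphic (four_to_triple_bij I).
  exact/bounded_lattice_morphism_le_mono/bij_inj/four_to_triple_bij.
- exists (@four_to_triple I).
  by split; [exact: four_to_triple_morphism|exact: four_to_triple_bij].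
- exists (@spectrum d A), eval_triple.
  by split; [exact: eval_triple_morphism|exact: eval_triple_inj].
Qed.
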